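(* Consider the Diophantine equation $$L_{n_1}L_{n_2}L_{n_3}\cdots L_{n_k}+1 = F_m^2$$ in integers $m\geq 0$, $k\geq 1$, and $0\leq n_1\leq n_2 \leq \cdots \leq n_k$. For a given $m\ge 0$, it has a solution if and only if $3\leq m\leq 7$, $m=10$, or $m = 14$. More precisely, the nontrivial solutions are exactly those given by \begin{align*} &L_2+1 = F_3^2,\quad L_0^3+1 = L_0L_3+1 = F_4^2,\quad L_0^3L_2+1 = L_0L_2L_3+1 = F_5^2,\\ &L_2^2L_4+1 = F_6^2,\quad L_0^3L_2L_4+1 = L_0L_2L_3L_4+1 = F_7^2, \\ &A+1 = F_{10}^2, \quad AL_8 +1 = F_{14}^2, \end{align*} where $A$ stands for any one of the five (numerically equal) products $$A = L_0^4L_2^3L_4 = L_0^3L_2L_4L_6 = L_0^2L_2^3L_3L_4 = L_0L_2L_3L_4L_6 = L_2^3L_3^2L_4.$$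
   Context: $(F_n)_{n\ge 0}$ is the Fibonacci sequence: $F_0=0$, $F_1=1$, $F_n=F_{n-1}+F_{n-2}$ for $n\ge 2$. $(L_n)_{n\ge 0}$ is the Lucas sequence: $L_0=2$, $L_1=1$, $L_n=L_{n-1}+L_{n-2}$ for $n\ge 2$. A solution is a tuple $(m,k,n_1,\dots,n_k)$; the indices $n_i$ need not be distinct, and in a displayed solution a power $L_n^a$ means that the index $n$ occurs $a$ times among $n_1,\dots,n_k$ (so each displayed product, with factors sorted by index, specifies a tuple). A solution is called nontrivial if either $k=1$, or $k\geq 2$ and $n_j\neq 1$ for every $j\in\{1,2,\ldots,k\}$. *)

(* Defs.v *)
From mathcomp Require Import all_boot.

Set Implicit Arguments.
Unset Strict Implicit.
Unset Printing Implicit Defensive.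

(* The standard library's [Zgcd_alt.fibonacci] is Z-valued and starts at 1, 1,
   so it is not the sequence F_0 = 0, F_1 = 1 used here. *)
Fixpoint fib (n : nat) : nat :=
  match n with
  | 0 => 0
  | 1 => 1
  | (n'.+1 as p).+1 => fib p + fib n'
  end.

Fixpoint lucas (n : nat) : nat :=
  match n with
  | 0 => 2
  | 1 => 1
  | (n'.+1 as p).+1 => lucas p + lucas n'
  end.

(* The indices n_1 <= ... <= n_k are the entries of a k-tuple, numbered from 0:
   n_(i+1) is [tnth n i]. *)
Definition solution (m k : nat) (n : k.-tuple nat) : Prop :=
  [/\ 1 <= k,
      sorted leq n
    & \prod_(i < k) lucas (tnth n i) + 1 = fib m ^ 2].

Definition nontrivial (k : nat) (n : k.-tuple nat) : Prop :=
  k = 1 \/ (2 <= k /\ forall j : 'I_k, tnth n j <> 1).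

(* A product L_(n_1) ... L_(n_k) is encoded by its index sequence
   [:: n_1; ...; n_k]; a power L_n^a contributes [nseq a n]. *)
Definition A_products : seq (seq nat) :=
  [:: nseq 4 0 ++ nseq 3 2 ++ [:: 4];
      nseq 3 0 ++ [:: 2; 4; 6];
      nseq 2 0 ++ nseq 3 2 ++ [:: 3; 4];
      [:: 0; 2; 3; 4; 6];
      nseq 3 2 ++ nseq 2 3 ++ [:: 4]].

Definition listed_solutions : seq (nat * seq nat) :=
  [:: (3, [:: 2]);
      (4, nseq 3 0);
      (4, [:: 0; 3]);
      (5, nseq 3 0 ++ [:: 2]);
      (5, [:: 0; 2; 3]);
      (6, nseq 2 2 ++ [:: 4]);
      (7, nseq 3 0 ++ [:: 2; 4]);
      (7, [:: 0; 2; 3; 4])]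
  ++ [seq (10, a) | a <- A_products]
  ++ [seq (14, rcons a 8) | a <- A_products].

(* Main.v *)
(* F_m^2 - 1 equals F_(m-1) F_(m+1) for m odd and F_(m-2) F_(m+2) for m even.
   If d is odd, then gcd(F_d, L_n) divides 2 and 4 does not divide F_d, so F_d
   divides a product of Lucas numbers only if d <= 3. Applied to the odd
   divisors of the two indices, this leaves m = 3, ..., 7, 10, 14. For these m
   every L_n divides 2^4 3^3 7 47, which forces n in {0, 1, 2, 3, 4, 6, 8}, and
   comparing the exponents of 2, 3, 7, 47 determines the multiplicities. *)
Require Import Defs.
From mathcomp Require Import all_boot.
From mathcomp Require Import zify.

Set Implicit Arguments.
Unset Strict Implicit.
Unset Printing Implicit Defensive.

(** * Identities and divisibility for Fibonacci and Lucas numbers *)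

Lemma fibS n : fib n.+2 = fib n.+1 + fib n.
Proof. by []. Qed.

Lemma lucasS n : lucas n.+2 = lucas n.+1 + lucas n.
Proof. by []. Qed.

Lemma lucas_gt0 n : 0 < lucas n.
Proof.
case: n => // n; elim: n => // n IHn.
by rewrite lucasS addn_gt0 IHn.
Qed.

Lemma leq_fib m n : m <= n -> fib m <= fib n.
Proof.
move=> /subnK <-; elim: (n - m) => // k /leq_trans -> //.
by rewrite addSn; case: (k + m) => // i; rewrite fibS leq_addr.
Qed.

Lemma leq_lucas m n : 0 < m -> m <= n -> lucas m <= lucas n.
Proof.
case: m => // m _ /subnK <-; elim: (n - m.+1) => // k /leq_trans -> //.
by rewrite addSn addnS lucasS leq_addr.
Qed.

Lemma fibD m n : fib (m + n).+1 = fib m.+1 * fib n.+1 + fib m * fib n.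
Proof.
elim: m n => [|m IHm] n; first by rewrite mul1n mul0n addn0.
by rewrite addSnnS IHm !fibS; lia.
Qed.

Lemma lucas_fib n : lucas n + fib n = 2 * fib n.+1.
Proof.
suff: lucas n + fib n = 2 * fib n.+1 /\ lucas n.+1 + fib n.+1 = 2 * fib n.+2.
  by case.
by elim: n => // n [IH0 IH1]; split=> //; rewrite lucasS !fibS in IH1 *; lia.
Qed.

Lemma fib_double n : fib n.*2 = fib n * lucas n.
Proof.
case: n => // n; rewrite doubleS -addnn -addnS fibD.
have := lucas_fib n.+1; rewrite fibS; nia.
Qed.

Lemma coprime_fib n : coprime (fib n) (fib n.+1).
Proof. by elim: n => // n IHn; rewrite fibS /coprime gcdnDl gcdnC. Qed.

Lemma dvdn_fib m n : m %| n -> fib m %| fib n.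
Proof.
case/dvdnP=> k ->; case: m => [|m]; first by rewrite muln0.
elim: k => // k IHk.
rewrite mulSn addSn fibD dvdn_add //; [exact: dvdn_mulr | exact: dvdn_mull].
Qed.

(** By the addition formula, modulo [d] only F_(m+1) F_n remains, and F_(m+1) is coprime to F_m,
    hence to [d]. *)
Lemma dvdn_fib_sub d m n : d %| fib m -> d %| fib (m + n) -> d %| fib n.
Proof.
case: n => [|n] dm; first by rewrite dvdn0.
rewrite addnS fibD dvdn_addl ?(dvdn_mulr _ dm) // Gauss_dvdr //.
exact: coprime_dvdl dm (coprime_fib m).
Qed.

(** Subtractive Euclidean algorithm on the indices, by induction on a bound for m + n. *)
Lemma dvdn_fib_gcd d m n : d %| fib m -> d %| fib n -> d %| fib (gcdn m n).
Proof.
have [k] := ubnP (m + n); elim: k m n => // k IHk m n lt_k.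
wlog le_mn : m n lt_k / m <= n => [hw dm dn|].
  case/orP: (leq_total m n) => le_mn; first exact: hw.
  by rewrite gcdnC; apply: hw; rewrite // addnC.
case: m le_mn lt_k => [|m] le_mn lt_k dm dn; first by rewrite gcd0n.
rewrite -(subnKC le_mn) gcdnDl; apply: IHk => //; first by lia.
by apply: dvdn_fib_sub dm _; rewrite subnKC.
Qed.

(* If p divides F_d and L_n with d odd, then p divides F_(2n) = F_n L_n, hence
   F_(gcd(2n, d)), hence F_n; but gcd(F_n, L_n) divides 2. *)
Lemma prime_dvd_fib_lucas p d n :
  prime p -> odd d -> p %| fib d -> p %| lucas n -> p = 2.
Proof.
move=> p_pr d_odd pd pl.
have pn : p %| fib n.
  have /dvdn_fib_gcd/(_ pd) p_gcd : p %| fib n.*2.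
    by rewrite fib_double dvdn_mull.
  apply: dvdn_trans p_gcd (dvdn_fib _).
  by rewrite gcdnC -muln2 Gauss_gcdl ?coprimen2 ?dvdn_gcdr.
have : p %| 2 * fib n.+1 by rewrite -lucas_fib dvdn_add.
rewrite Euclid_dvdM // (dvdn_prime2 p_pr) // => /orP[/eqP //|pn1].
have : p %| gcdn (fib n) (fib n.+1) by rewrite dvdn_gcd pn.
by rewrite (eqP (coprime_fib n)) dvdn1 => /eqP p1; rewrite p1 in p_pr.
Qed.

(** * Periodicity modulo small integers *)

Definition fstep q (x : nat * nat) := (x.2, (x.1 + x.2) %% q).

Lemma fstep_iterE q (u : nat -> nat) n : (forall i, u i.+2 = u i.+1 + u i) ->
  iter n (fstep q) (u 0 %% q, u 1 %% q) = (u n %% q, u n.+1 %% q).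
Proof.
move=> uS; elim: n => // n IHn.
by rewrite iterS IHn /fstep /= modnDm addnC uS.
Qed.

Lemma modn_periodic q P (u : nat -> nat) n :
    (forall i, u i.+2 = u i.+1 + u i) ->
    iter P (fstep q) (u 0 %% q, u 1 %% q) = (u 0 %% q, u 1 %% q) ->
  u n %% q = (iter (n %% P) (fstep q) (u 0 %% q, u 1 %% q)).1.
Proof.
move=> uS periodP; rewrite -[LHS]/((u n %% q, u n.+1 %% q).1) -fstep_iterE //.
congr _.1; rewrite {1}(divn_eq n P) addnC iterD; congr iter.
by elim: (n %/ P) => // k IHk; rewrite mulSn iterD IHk.
Qed.

(** Reduces a divisibility criterion to evaluation over one period [P], iterating on pairs of
    residues so that numbers stay small. *)
Lemma dvdn_periodic q P (A : pred nat) (u : nat -> nat) n :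
    (forall i, u i.+2 = u i.+1 + u i) -> 0 < P ->
    iter P (fstep q) (u 0 %% q, u 1 %% q) = (u 0 %% q, u 1 %% q) ->
    all (fun i => ((iter i (fstep q) (u 0 %% q, u 1 %% q)).1 == 0) ==> A i)
      (iota 0 P) ->
  q %| u n -> A (n %% P).
Proof.
move=> uS P_gt0 periodP /allP/(_ (n %% P)); rewrite mem_iota ltn_mod P_gt0.
move=> /(_ isT)/implyP AP; rewrite /dvdn (modn_periodic _ uS periodP).
exact: AP.
Qed.

(** Here and below the second argument of [dvdn_periodic] is the period: 6 for F modulo 4; 12, 8,
    16, 32 for L modulo 8, 3, 7, 47. *)
Lemma dvd4_fib n : 4 %| fib n -> ~~ odd n.
Proof.
move/(@dvdn_periodic 4 6 (fun i => ~~ odd i) fib n fibS isT erefl isT).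
by rewrite odd_mod //; apply.
Qed.

Lemma dvd8_lucas n : ~~ (8 %| lucas n).
Proof.
by apply/negP=> /(@dvdn_periodic 8 12 pred0 lucas n lucasS isT erefl isT).
Qed.

Lemma dvd3_lucas n : 3 %| lucas n -> n %% 4 = 2.
Proof.
move/(@dvdn_periodic 3 8 (fun i => i %% 4 == 2) lucas n lucasS isT erefl isT).
by rewrite modn_dvdm // => /eqP.
Qed.

Lemma dvd7_lucas n : 7 %| lucas n -> n %% 8 = 4.
Proof.
move/(@dvdn_periodic 7 16 (fun i => i %% 8 == 4) lucas n lucasS isT erefl isT).
by rewrite modn_dvdm // => /eqP.
Qed.

Lemma dvd47_lucas n : 47 %| lucas n -> n %% 16 = 8.
Proof.
move/(@dvdn_periodic 47 32 (fun i => i %% 16 == 8) lucas n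
  lucasS isT erefl isT).
by rewrite modn_dvdm // => /eqP.
Qed.

(** * The possible values of m *)

Lemma odd_fib_dvd_prod_lucas (s : seq nat) d :
  odd d -> fib d %| \prod_(i <- s) lucas i -> d <= 3.
Proof.
move=> d_odd dvd_prod; rewrite leqNgt; apply/negP=> d_gt3.
have fib_gt2 : 2 < fib d by exact: leq_fib d_gt3.
have /p_natP[k def_fib] : 2.-nat (fib d).
  apply/pnatP=> [|p p_pr p_dvd]; first by lia.
  move: (dvdn_trans p_dvd dvd_prod); rewrite Euclid_dvd_prod // big_has.
  case/hasP=> i _ /(prime_dvd_fib_lucas p_pr d_odd p_dvd) ->.
  by rewrite inE.
case: k def_fib => [|[|k]] def_fib; try by rewrite def_fib in fib_gt2.
have : 4 %| fib d by rewrite def_fib -[4]/(2 ^ 2) dvdn_exp2l.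
by move/dvd4_fib; rewrite d_odd.
Qed.

(** The sign (-1)^n is split between the two sides as parity bits, which avoids truncated
    subtraction. *)
Lemma cassini n : fib n.+1 ^ 2 + odd n = fib n * fib n.+2 + ~~ odd n.
Proof. by elim: n => // n; rewrite oddS !fibS; case: (odd n) => /=; nia. Qed.

Lemma catalan2 n : fib n.+2 ^ 2 + odd n = fib n * fib n.+4 + ~~ odd n.
Proof. by have := cassini n; rewrite !fibS; case: (odd n) => /=; nia. Qed.

(** One of j, j + 1 is odd, and it is then its own odd divisor. *)
Lemma consecutive_odd_divisors j : 0 < j ->
  (forall d, odd d -> d %| j \/ d %| j.+1 -> d <= 3) -> 1 <= j <= 3.
Proof.
move=> j_gt0 small; case j_odd: (odd j).
  by have := small j j_odd (or_introl (dvdnn j)); lia.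
have := small j.+1; rewrite oddS j_odd => /(_ isT (or_intror (dvdnn _))).
lia.
Qed.

Lemma solution_index (s : seq nat) m : \prod_(i <- s) lucas i + 1 = fib m ^ 2 ->
  m \in [:: 3; 4; 5; 6; 7; 10; 14].
Proof.
set X := \prod_(i <- s) _ => defX.
have X_gt0 : 0 < X by rewrite prodn_gt0 // => i; exact: lucas_gt0.
have small a b : X = fib a * fib b ->
    forall d, odd d -> d %| a \/ d %| b -> d <= 3.
  move=> Xab d d_odd d_dvd; apply: (@odd_fib_dvd_prod_lucas s) => //.
  rewrite -/X Xab; case: d_dvd => /dvdn_fib h.
    exact: dvdn_mulr.
  exact: dvdn_mull.
(* Used with c = 2 for m = 2j + 1 and with c = 4 for m = 4j + 2. *)
have smallM c j : X = fib (c * j) * fib (c * j.+1) -> 1 <= j <= 3.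
  move=> Xj; apply: consecutive_odd_divisors => [|d d_odd d_dvd].
    by case: j Xj => // Xj; rewrite Xj muln0 in X_gt0.
  apply: (small _ _ Xj d d_odd); case: d_dvd => h; [left|right];
    exact: dvdn_mull.
case m_odd: (odd m).
  have [j defm] : exists j, m = (2 * j).+1 by exists m./2; lia.
  have := cassini (2 * j); rewrite -{1}defm -defX oddM addn0 => /addIn.
  rewrite -[(2 * j).+2]/(2 + 2 * j) -mulnS => /smallM.
  by rewrite defm; case: (j) => [|[|[|[|]]]].
case: m m_odd defX => [|[|m]] m_odd defX //; first by rewrite addn1 in defX.
have := catalan2 m; rewrite -defX; rewrite /= negbK in m_odd.
rewrite m_odd addn0 => /addIn Xm.
(* The original index is now m + 2. If 4 divides m = 4j, it is 6, 10 or 14. Otherwise m / 2 + 2 is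
   an odd divisor of m + 4, which forces m = 2 and the index 4. *)
case m4: (4 %| m).
  case/dvdnP: m4 Xm => j ->.
  rewrite (mulnC j) -[(4 * j).+4]/(4 + 4 * j) -mulnS => /smallM.
  by case: (j) => [|[|[|[|]]]].
have m_half : odd (m./2 + 2) by lia.
have : m./2 + 2 <= 3.
  apply: (small _ _ Xm) => //; right; apply/dvdnP; exists 2; lia.
by move=> le3; have -> : m = 2 by lia.
Qed.

(** * Lucas numbers dividing 2^4 3^3 7 47 *)

Definition lucas_support := [:: 0; 2; 3; 4; 6; 8].

(** Lets a gcd with a product of prime powers be bounded one factor at a time. *)
Lemma gcdn_mulr_dvd d m n m' n' :
  gcdn d m %| m' -> gcdn d n %| n' -> gcdn d (m * n) %| m' * n'.
Proof.
move=> dm dn; apply: dvdn_trans (dvdn_mul dm dn).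
rewrite muln_gcdl dvdn_gcd; apply/andP; split.
  by apply: dvdn_trans (dvdn_gcdl _ _) _; apply: dvdn_mulr.
rewrite muln_gcdr dvdn_gcd dvdn_gcdr andbT.
by apply: dvdn_trans (dvdn_gcdl _ _) _; apply: dvdn_mull.
Qed.

Lemma gcdn_prime_exp d p k :
  prime p -> gcdn d (p ^ k) %| (if p %| d then p ^ k else 1).
Proof.
move=> p_pr; case: ifP => pd; first exact: dvdn_gcdr.
have cop : coprime d (p ^ k).
  by rewrite coprimeXr // coprime_sym prime_coprime ?pd.
by rewrite (eqP cop).
Qed.

(** The divisors of 16 that do not divide 4 are 8 and 16, both excluded by [dvd8_lucas]. *)
Lemma gcdn_lucas16 n : gcdn (lucas n) (2 ^ 4) %| 4.
Proof.
have := dvd8_lucas n; have := dvdn_gcdr (lucas n) 16.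
have := dvdn_gcdl (lucas n) 16; rewrite -[2 ^ 4]/16.
move: (gcdn _ _) => g gL g16 /negP ndvd.
have g_le : g <= 16 by exact: dvdn_leq.
by do 17?[case: g g_le gL g16 => [//|g] g_le gL g16];
  case: ndvd; apply: dvdn_trans gL.
Qed.

(* At most one of 3, 7, 47 divides L_n, and 8 does not, so that
   L_n <= 4 * 47 < L_11. *)
Lemma lucas_dvd_support n : lucas n %| 2 ^ 4 * 3 ^ 3 * 7 ^ 1 * 47 ^ 1 ->
  n \in 1 :: lucas_support.
Proof.
move=> dvdL.
have {dvdL} : lucas n %| 4 * (if 3 %| lucas n then 3 ^ 3 else 1)
    * (if 7 %| lucas n then 7 ^ 1 else 1)
    * (if 47 %| lucas n then 47 ^ 1 else 1).
  rewrite -{1}[lucas n](gcdn_idPl dvdL).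
  by do 3?[apply: gcdn_mulr_dvd; last exact: gcdn_prime_exp];
    exact: gcdn_lucas16.
have := @dvd3_lucas n; have := @dvd7_lucas n; have := @dvd47_lucas n.
do 3![case: ifP => _] => h47 h7 h3;
  try by [have := h3 isT; have := h7 isT; lia |
          have := h3 isT; have := h47 isT; lia |
          have := h7 isT; have := h47 isT; lia].
all: move=> dvdL; have n_lt : n < 11.
all: try by rewrite ltnNge; apply/negP=> /(@leq_lucas 11 n isT);
     apply/negP; rewrite -ltnNge; apply: leq_ltn_trans (dvdn_leq _ dvdL) _.
all: clear h3 h7 h47.
all: by do 11?[case: n dvdL n_lt => [//|n] dvdL n_lt].
Qed.

(** * Exponent vectors over the primes 2, 3, 7, 47 *)

Definition smooth (e : nat * nat * nat * nat) :=
  let: (a, b, c, d) := e in 2 ^ a * 3 ^ b * 7 ^ c * 47 ^ d.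

(** Each exponent is recovered as a p-adic valuation. *)
Lemma smooth_inj : injective smooth.
Proof.
have logE p e : prime p -> logn p (smooth e) =
    e.1.1.1 * (p == 2) + e.1.1.2 * (p == 3) + e.1.2 * (p == 7) + e.2 * (p == 47).
  case: e => [[[a b] c] d] p_pr.
  by rewrite /smooth !lognM ?muln_gt0 ?expn_gt0 // !lognX !logn_prime.
move=> e e' eq_e; have E p := congr1 (logn p) eq_e.
have := (E 2, E 3, E 7, E 47); rewrite !logE //=.
case: e e' {eq_e E} => [[[a b] c] d] [[[a' b'] c'] d'] /=.
by rewrite !muln0 !muln1 !addn0 !add0n => -[[[-> ->] ->] ->].
Qed.

(* Exponents of 2, 3, 7, 47 in a product of factors
   L_0 = 2, L_2 = 3, L_3 = 2^2, L_4 = 7, L_6 = 2 * 3^2, L_8 = 47. *)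
Definition exponents (s : seq nat) :=
  (count_mem 0 s + 2 * count_mem 3 s + count_mem 6 s,
   count_mem 2 s + 2 * count_mem 6 s, count_mem 4 s, count_mem 8 s).

Lemma prod_lucasE s : all (mem lucas_support) s ->
  \prod_(i <- s) lucas i = smooth (exponents s).
Proof.
elim: s => [_|x s IHs]; first by rewrite big_nil.
move=> /andP[x_supp /IHs]; rewrite big_cons /exponents /= => ->.
move: x_supp; rewrite !inE.
by do !case/orP; do [move/eqP-> | move=> /eqP ->];
  rewrite /= ?mulnDr ?expnD ?expnS ?add0n ?expn0 ?muln1 ?muln0; nia.
Qed.

(** Factorizations of F_m^2 - 1 for the indices m left by [solution_index]. *)
Definition fib_sqr_table : seq (nat * (nat * nat * nat * nat)) :=
  [:: (3, (0, 1, 0, 0)); (4, (3, 0, 0, 0)); (5, (3, 1, 0, 0));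
      (6, (0, 2, 1, 0)); (7, (3, 1, 1, 0)); (10, (4, 3, 1, 0));
      (14, (4, 3, 1, 1))].

Lemma fib_sqr_tableP m e : (m, e) \in fib_sqr_table -> fib m ^ 2 = smooth e + 1.
Proof.
rewrite !inE; do ![case/orP]; move=> /eqP[-> ->] //.
Qed.

Lemma fib_sqr_table_index m :
  m \in [seq x.1 | x <- fib_sqr_table] -> exists e, (m, e) \in fib_sqr_table.
Proof. by case/mapP=> -[m' e] m_e ->; exists e. Qed.

(** * Enumeration of the multiplicities *)

Definition support_counts (s : seq nat) :=
  [seq count_mem i s | i <- lucas_support].

(** Equal multiplicities make the sequences permutations of each other, and a sorted permutation is
    unique. *)
Lemma support_counts_inj s t :
    sorted leq s -> sorted leq t ->
    all (mem lucas_support) s -> all (mem lucas_support) t ->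
  support_counts s = support_counts t -> s = t.
Proof.
move=> s_sorted t_sorted /allP s_supp /allP t_supp /eq_in_map eq_counts.
apply: (sorted_eq leq_trans anti_leq) => //.
apply/allP=> i; rewrite mem_cat => /orP i_st.
by apply/eqP/eq_counts; case: i_st; [exact: s_supp | exact: t_supp].
Qed.

Lemma listed_solutions_valid m s : (m, s) \in listed_solutions ->
  [/\ s != [::], sorted leq s, all (mem lucas_support) s
    & (m, exponents s) \in fib_sqr_table].
Proof.
have /allP h : all (fun x => [&& x.2 != [::], sorted leq x.2,
    all (mem lucas_support) x.2 & (x.1, exponents x.2) \in fib_sqr_table])
    listed_solutions by [].
by move/h/and4P.
Qed.

Lemma listed_solutions_counts m s : (m, exponents s) \in fib_sqr_table ->
  (m, support_counts s) \in
    [seq (x.1, support_counts x.2) | x <- listed_solutions].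
Proof.
rewrite /exponents /support_counts [map _ lucas_support]/=.
move: (count_mem 0 s) (count_mem 2 s) (count_mem 3 s) => c0 c2 c3.
move: (count_mem 4 s) (count_mem 6 s) (count_mem 8 s) => c4 c6 c8.
(* Given the exponents a of 2 and b of 3, the counts [c0] and [c2] are determined by [c3] and [c6].
   As a <= 4 and b <= 3, only [c3] <= 2 and [c6] <= 1 remain to be evaluated. *)
set a := (c0 + _ + _); set b := (c2 + _).
have a_ge : 2 * c3 + c6 <= a by rewrite /a; lia.
have b_ge : 2 * c6 <= b by rewrite /b; lia.
have -> : c0 = a - (2 * c3 + c6) by rewrite /a; lia.
have -> : c2 = b - 2 * c6 by rewrite /b; lia.
move: a b a_ge b_ge => a b a_ge b_ge.
rewrite !(in_cons, in_nil) orbF.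
by do ![case/orP] => /eqP[-> def_a def_b -> ->];
  rewrite {}def_a {}def_b in a_ge b_ge *;
  case: c6 a_ge b_ge => [|[|c6]] a_ge b_ge //;
  case: c3 a_ge => [|[|[|c3]]] a_ge; try by []; exfalso; lia.
Qed.

Lemma listed_solutionsP m s : s != [::] -> sorted leq s ->
  (\prod_(i <- s) lucas i + 1 = fib m ^ 2 /\ 1 \notin s) <->
  (m, s) \in listed_solutions.
Proof.
move=> s_n0 s_sorted.
split=> [[prodE s_n1] | /listed_solutions_valid[_ _ s_supp m_e]].
  have /fib_sqr_table_index[[[[a b] c] d] m_e] := solution_index prodE.
  have prodS : \prod_(i <- s) lucas i = smooth (a, b, c, d).
    by apply: (@addIn 1); rewrite prodE (fib_sqr_tableP m_e).
  have s_supp : all (mem lucas_support) s.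
    apply/allP=> i i_s; have : i \in 1 :: lucas_support.
      apply: lucas_dvd_support; apply: (@dvdn_trans (smooth (a, b, c, d))).
        by rewrite -prodS (big_rem i) //= dvdn_mulr.
      (* All table entries divide the common multiple 2^4 3^3 7 47. *)
      have /allP/(_ _ m_e)/and4P[a4 b3 c1 d1] : all (fun x : nat * _ =>
        let: (a, b, c, d) := x.2 in [&& a <= 4, b <= 3, c <= 1 & d <= 1])
        fib_sqr_table by [].
      by rewrite /smooth !dvdn_mul ?dvdn_exp2l.
    by rewrite in_cons => /predU1P[i1 | //]; rewrite -i1 i_s in s_n1.
  rewrite prod_lucasE // in prodS; rewrite -(smooth_inj prodS) in m_e.
  have /mapP[[m' t] t_listed eq_mt] := listed_solutions_counts m_e.
  have [/= -> eq_counts] := (congr1 fst eq_mt, congr1 snd eq_mt).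
  have [_ t_sorted t_supp _] := listed_solutions_valid t_listed.
  by rewrite (support_counts_inj s_sorted t_sorted s_supp t_supp eq_counts).
split; last by apply: contraL s_supp => s1; apply/allPn; exists 1.
by rewrite prod_lucasE // (fib_sqr_tableP m_e).
Qed.

Theorem theorem6 :
  (forall m : nat,
     (exists (k : nat) (n : k.-tuple nat), solution m n) <->
     (3 <= m <= 7 \/ m = 10 \/ m = 14)) /\
  (forall (m k : nat) (n : k.-tuple nat),
     solution m n /\ nontrivial n <-> (m, tval n) \in listed_solutions).
Proof.
have solutionE m k (n : k.-tuple nat) : solution m n <->
    [/\ n != [::] :> seq nat, sorted leq n
      & \prod_(i <- n) lucas i + 1 = fib m ^ 2].
  by rewrite /solution (big_tuple _ _ n) -size_eq0 size_tuple -lt0n.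
have classify m k (n : k.-tuple nat) :
    solution m n /\ nontrivial n <-> (m, tval n) \in listed_solutions.
  split=> [[/solutionE[n_n0 n_sorted prodE] n_nontriv] | n_listed].
    apply/listed_solutionsP => //; split=> //.
    case: n_nontriv => [k1 | [_ n_n1]].
      (* For k = 1, the index 1 would give the product L_1 = 1, whose exponent vector is zero and
         absent from the table. *)
      apply/negP=> n1; have m_index := solution_index prodE.
      move: m_index prodE.
      have -> : tval n = [:: 1].
        have : size n = 1 by rewrite size_tuple.
        by case: (tval n) n1 => [|x [|y s]] //; rewrite mem_seq1 => /eqP ->.
      rewrite big_seq1 => /fib_sqr_table_index[e m_e].
      rewrite (fib_sqr_tableP m_e).
      move/addIn; rewrite -[lucas 1]/(smooth (0, 0, 0, 0)) => /smooth_inj e0.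
      by rewrite -e0 !inE !xpair_eqE !andbF in m_e.
    by apply/negP=> /tnthP[j /esym]; exact: n_n1.
  have [n_n0 n_sorted _ _] := listed_solutions_valid n_listed.
  have /listed_solutionsP[//|//|prodE n_n1] := n_listed.
  split; first exact/solutionE.
  have k_gt0 : 0 < k by rewrite -(size_tuple n) lt0n size_eq0.
  have [k1|k_gt1] : k = 1 \/ 2 <= k by lia.
    by left.
  by right; split=> // j nj; rewrite -nj mem_tnth in n_n1.
(* [solution_index] covers trivial solutions as well; conversely each admissible m occurs in the
   list. *)
split=> // m; split=> [[k [n /solutionE[_ _ /solution_index]]] | m_range].
  by rewrite !inE; lia.
have /mapP[[m' s] /= s_listed ->] : m \in [seq x.1 | x <- listed_solutions].
  by rewrite /= !inE; lia.
by exists (size s), (in_tuple s); case/(classify m' _ (in_tuple s)): s_listed.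
Qed.
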